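(* Let $Ay(t)=Bu(t)$ be a causal nonlinear discrete system, where $A$ is a $\delta$-polynomial and $B$ is an $\epsilon$-polynomial with $d(A)<d(B)$. Suppose that $\mathbf{L}$ and $\mathbf{M}$ are the outputs of the Linear-Equivalence Algorithm I (described in the context) applied to the input $A,B$. Then for every $L\in\mathbf{L}$ and $M\in\mathbf{M}$ the linear system $Ly(t)=Mu(t)$ is equivalent to the original nonlinear system $Ay(t)=Bu(t)$.
   Context: **Operators and polynomials.** $F$ is the set of causal real sequences $y:\mathbb{Z}\to\mathbb{R}$, $y(t)=0$ for $t<0$. A multiindex is a finite tuple $\mathbf{i}=(i_1\le\dots\le i_n)$ of nonnegative integers (delays); $e$ denotes the empty multiindex. Define $\delta_{\mathbf{i}}y(t)=y(t-i_1)\cdots y(t-i_n)$ and $\epsilon_{\mathbf{j}}u(t)=u(t-j_1)\cdots u(t-j_m)$; $\delta_e$ and $\epsilon_e$ give the constant $1$. $\delta$ acts on outputs, $\epsilon$ on inputs. A $\delta$-polynomial (resp. $\epsilon$-polynomial) is a finite real linear combination of operators $\delta_{\mathbf{i}}$ (resp. $\epsilon_{\mathbf{j}}$). It is linear if it has the form $\sum_i c_i\delta_i$ (resp. $\sum_j c_j\epsilon_j$) with single indices $i,j$. $d(A)$ is the minimum delay occurring in $A$. The star-product is composition (substitution): $(A\ast L)y=A(Ly)$. In particular $\delta_{\mathbf{i}}\ast L$ is the product over $a$ of the polynomials obtained from $L$ by shifting all its delays by $i_a$; similarly for $\epsilon$. Among linear polynomials $\ast$ is the usual multiplication of polynomials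 in the shift, and $\gcd$ refers to this product (it is determined up to a nonzero real factor). **Order.** $\mathbf{i}<\mathbf{j}$ if $\mathbf{i}$ is shorter than $\mathbf{j}$, or they have equal length and the right-most nonzero entry of $\mathbf{j}-\mathbf{i}$ is positive. The maximum term of a polynomial is the one with largest multiindex. **Formal factorization.** Let $A$ be a $\delta$-polynomial with linear part $A_l$ and nonlinear part $A_{nl}$. Starting from $A_{nl}$, repeat for $k=1,2,\dots$: a zero term is one containing the delay $0$. Let $c_k\delta_{i_1}\cdots\delta_{i_n}$, $i_1\le\dots\le i_n$, be the maximum non-zero term (i.e. the maximum term which is not a zero term) of the current polynomial. Put $L_k=w_{k0}\delta_0+w_{k1}\delta_1+\dots+w_{k,i_1-1}\delta_{i_1-1}+\delta_{i_1}$ with new real parameters $w_{kj}$. Subtract $c_k\,\delta_0\delta_{i_2-i_1}\cdots\delta_{i_n-i_1}\ast L_k$ from the current polynomial. Stop when only zero terms remain; what remains is the remainder $R_\delta$. The coefficients $c_k$ are functions of the parameters $w_{ij}$. Adding the summand $\delta_0\ast A_l$ (with coefficient $1$ and linear polynomial $A_l$) gives $\mathrm{Formal}[A]=\sum_{k=1}^{\omega}c_k(w_{ij})\,\delta_{\mathbf{i}_k}\ast L_k+R_\delta$. The same procedure for an $\epsilon$-polynomial $B$, with parameters $s_{ij}$, gives $\mathrm{Formal}[B]=\sum_{\rho=1}^{\varphi}c'_\rho(s_{ij})\,\epsilon_{\mathbf{j}_\rho}\ast M_\rho+R_\epsilon$. A substitution rule assigns real values $(w_{ij},s_{ij})=(a_{ij},b_{ij})$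 to the parameters; $X|_U$ denotes the evaluation of $X$ at the rules belonging to a set $U$ of rules. **Proper.** A $\delta$-polynomial $A$ is proper if in every term of $A$ in which the operator $\delta_\alpha$ of minimum delay $\alpha=d(A)$ appears, it appears to the power one. An $\epsilon$-polynomial is called proper if the $\delta$-polynomial obtained by replacing each $\epsilon$ by $\delta$ is proper. A $\delta$-polynomial $\hat A$ and an $\epsilon$-polynomial $\hat B$ are called equal, $\hat A=\hat B$, if they have the same coefficients at the same multiindices. **Linear-Equivalence Algorithm I.** Input: nonlinear polynomials $A$ ($\delta$) and $B$ ($\epsilon$). Step 1: compute $\mathrm{Formal}[A]$ and $\mathrm{Formal}[B]$. Step 2: form the set $U$ of rules $(w_{ij},s_{ij})=(a_{ij},b_{ij})$, $a_{ij},b_{ij}\in\mathbb{R}$, such that the following hold simultaneously: (1) $R_\delta|_U=R_\epsilon|_U=0$; (2) the sets $\mathbf{L}=\{L: L=\gcd_k(L_k|_U)\}$ and $\mathbf{M}=\{M: M=\gcd_\rho(M_\rho|_U)\}$ (the chosen greatest common divisors of the evaluated linear polynomials, as the rule ranges over $U$) are nonempty; (3) for $L\in\mathbf{L}$, $M\in\mathbf{M}$, the polynomials $\hat A,\hat B$ with $A=\hat A\ast L$ and $B=\hat B\ast M$ are proper and $\hat A=\hat B$. Step 3: if $U\ne\emptyset$, output $\mathbf{L},\mathbf{M}$; otherwise the method fails (there is no output). **Systems.** The system $Ay(t)=Bu(t)$ is causal if $d(A_l)=d(A)<d(B)$, where $A_l$ is the linear part of $A$. With $k$ the maximum output delay,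 initial conditions are prescribed values $y(0),\dots,y(k-1)$, and for each input $u\in F$ the output $y\in F$ satisfies the equation for $t\ge k$. Two systems with outputs $y,\psi$ and maximum output delays $k\ge\lambda$ have identical initial conditions if $\psi(t)=y(t)$ for $0\le t\le\lambda-1$ (the prescribed values agree) and the prescribed values $y(\lambda),\dots,y(k-1)$ of the first system are the corresponding outputs $\psi(\lambda),\dots,\psi(k-1)$ of the second. Two systems are equivalent if their outputs coincide for all $t$ whenever their inputs coincide and their initial conditions are identical.
   Formalization: An output is required to be the only solution with its input and initial conditions; without this the claim fails, e.g. for A=(δ0+δ0δ1)∗(δ0+δ1), B=(ε0+ε0ε1)∗ε1 with u=−1 for t≥0, where y(2) is arbitrary. *)

(* Defs.v *)
From HB Require Import structures.
From mathcomp Require Import all_boot all_order all_algebra finmap.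
From mathcomp Require Import monalg.
From mathcomp Require Import classical_sets reals.

Set Implicit Arguments.
Unset Strict Implicit.
Unset Printing Implicit Defensive.

Import Order.TTheory GRing.Theory Num.Theory.
Local Open Scope ring_scope.

Record multiindex := MultiIndex { mi_seq :> seq nat; _ : sorted leq mi_seq }.

HB.instance Definition _ := [isSub for mi_seq].
HB.instance Definition _ := [Choice of multiindex by <:].

Definition mi_of (s : seq nat) : multiindex :=
  MultiIndex (sort_sorted leq_total s).

(* The product of operators, delta_i delta_j, is delta of the sorted
   concatenation of i and j, and delta_e = 1. *)
Definition mi_mul (i j : multiindex) : multiindex := mi_of (i ++ j).

Fact mi_ofK (i : multiindex) : mi_of i = i.
Proof. by apply: val_inj => /=; apply/(sorted_sort leq_trans)/(valP i). Qed.

Fact mi_of_perm (s t : seq nat) : perm_eq s t -> mi_of s = mi_of t.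
Proof.
by move=> st; apply/val_inj/(perm_sortP leq_total leq_trans anti_leq).
Qed.

Fact mi_mulA : associative mi_mul.
Proof.
move=> i j k; apply: mi_of_perm => /=.
rewrite (permPr (perm_cat (permEl (perm_sort _ _)) (perm_refl _))) -catA.
by rewrite perm_cat2l; apply: permEl; exact: perm_sort.
Qed.

Fact mi_mul1 : left_id (mi_of [::]) mi_mul.
Proof. by move=> i; exact: mi_ofK. Qed.

Fact mi_mulC : commutative mi_mul.
Proof. by move=> i j; apply: mi_of_perm; rewrite perm_catC. Qed.

Fact mi_mulr1 : right_id (mi_of [::]) mi_mul.
Proof. by move=> i; rewrite mi_mulC mi_mul1. Qed.

Fact mi_unit (i j : multiindex) :
  mi_mul i j = mi_of [::] -> i = mi_of [::] /\ j = mi_of [::].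
Proof.
move/(congr1 (size \o val)); rewrite /= size_sort size_cat => /eqP.
rewrite addn_eq0 !size_eq0 => /andP[/eqP i0 /eqP j0].
by split; apply: val_inj.
Qed.

HB.instance Definition _ := Choice_isMonomialDef.Build multiindex
  mi_mulA mi_mul1 mi_mulr1 mi_unit.
HB.instance Definition _ := MonomialDef_isConomialDef.Build multiindex mi_mulC.

(* j - i is the entrywise difference; past the common size both entries
   are 0. *)
Definition mi_lt (i j : multiindex) : Prop :=
  (size i < size j)%N \/
  (size i = size j /\
   exists2 p, (nth 0 i p < nth 0 j p)%N &
     forall q, (p < q)%N -> nth 0 i q = nth 0 j q)%N.

(* The coefficients of the polynomials A and B are real, those of a formal
   factorization are polynomials in the parameters; hence the generality in K.
   delta- and epsilon-polynomials are both of type [dpoly]: they differ only in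
   the sequence they act on, and equality of a delta-polynomial with an
   epsilon-polynomial is equality of coefficients. *)
Notation dpoly K := {malg K[multiindex]}.

Section DelayPolynomials.
Variable K : comNzRingType.
Implicit Types (A : dpoly K) (p L : {poly K}).

(* Linear polynomials are encoded by ordinary polynomials in the shift:
   \sum_j p_j X^j stands for \sum_j p_j delta_j. *)
Definition lin p : dpoly K := \sum_(j < size p) << p`_j *g mi_of [:: val j] >>.

Definition maxdelay A : nat := \max_(i <- msupp A) \max_(a <- mi_seq i) a.

(* d(A); it is 0 by convention when no delay occurs in A. *)
Definition mindelay A : nat :=
  \big[minn/maxdelay A]_(i <- msupp A) \big[minn/maxdelay A]_(a <- mi_seq i) a.

Definition linpart A : {poly K} :=
  \poly_(j < (maxdelay A).+1) A@_(mi_of [:: j]).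

Definition nonlinpart A : dpoly K := A - lin (linpart A).

Definition is_linear A : Prop := exists p, A = lin p.

(* A * L : substitute L, with all its delays shifted by a, for each delta_a. *)
Definition star A L : dpoly K :=
  mmap (@malgC _ K) (fun i : multiindex => \prod_(a <- mi_seq i) lin ('X^a * L))
    A.

Definition proper A : Prop :=
  forall i, i \in msupp A -> mindelay A \in mi_seq i ->
    count_mem (mindelay A) (mi_seq i) = 1%N.

(* act A y t is (A y)(t). *)
Definition act_mi (y : int -> K) (t : int) (i : multiindex) : K :=
  \prod_(a <- mi_seq i) y (t - a%:Z).

Definition act A (y : int -> K) (t : int) : K := mmap idfun (act_mi y t) A.

Fact act_mi_is_multiplicative y t : mmorphism (act_mi y t).
Proof.
split=> [i j|]; last by rewrite /act_mi (_ : mi_seq _ = [::]) ?big_nil.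
by rewrite /act_mi (perm_big _ (permEl (perm_sort leq (i ++ j)))) big_cat.
Qed.

HB.instance Definition _ y t :=
  isMultiplicative.Build multiindex K (act_mi y t)
    (act_mi_is_multiplicative y t).

Fact act_lin n y t p : (size p <= n)%N ->
  act (lin p) y t = \sum_(j < n) p`_j * y (t - j%:Z).
Proof.
move=> le_pn; rewrite /act /lin raddf_sum.
rewrite (big_ord_widen n (fun j : nat =>
  mmap idfun (act_mi y t) << p`_j *g mi_of [:: j] >>) le_pn) big_mkcond /=.
apply: eq_bigr => j _; rewrite mmapU /act_mi (_ : mi_seq _ = [:: val j]) //.
by rewrite big_seq1; case: ltnP => // /(nth_default 0) ->; rewrite mul0r.
Qed.

(* The star-product is the composition of operators. *)
Fact act_star A L y t : act (star A L) y t = act A (act (lin L) y) t.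
Proof.
rewrite /star mmapE /act raddf_sum [RHS]mmapE; apply: eq_bigr => i _ /=.
rewrite rmorphM /= mmapC; congr (_ * _).
rewrite rmorph_prod; apply: eq_bigr => a _ /=.
have szL : (size ('X^a * L)%R <= a + size L)%N.
  rewrite (leq_trans (size_polyMleq _ _)) // size_polyXn; exact: leqnn.
rewrite -[LHS]/(act _ _ _) (act_lin _ _ szL) -[RHS]/(act (lin L) y (t - a%:Z)).
rewrite (act_lin _ _ (leqnn _)).
rewrite big_split_ord /= big1 ?add0r => [|j _]; last first.
  by rewrite coefXnM ltn_ord mul0r.
apply: eq_bigr => j _; rewrite coefXnM ltnNge leq_addr /= addKn.
by rewrite PoszD opprD addrA.
Qed.

(* Only a term with at least one delay has a first delay i_1 that can be
   factored out, so a constant term is never selected: it stays in the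
   remainder. *)
Definition factorable (i : multiindex) : bool :=
  (mi_seq i != [::]) && (0%N \notin mi_seq i).

Definition is_max_nonzero_term A (i : multiindex) : Prop :=
  [/\ i \in msupp A, factorable i &
      forall j, j \in msupp A -> factorable j -> j <> i -> mi_lt j i].

Definition first_delay (i : multiindex) : nat := head 0%N i.

Definition reduce (i : multiindex) : multiindex :=
  mi_of [seq (a - first_delay i)%N | a <- mi_seq i].

(* The summand c delta_i * L is recorded as the triple (c, i, L). *)
Definition summand : Type := K * multiindex * {poly K}.

(* [factors w k P s Q]: started on P at step k, with parameters w, the loop
   extracts the summands s in this order, and stops with remainder Q. *)
Inductive factors (w : nat -> nat -> K) :
    nat -> dpoly K -> seq summand -> dpoly K -> Prop :=
| factors_stop k P :
    (forall i, i \in msupp P -> ~~ factorable i) -> factors w k P [::] P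
| factors_step k P i s Q :
    is_max_nonzero_term P i ->
    let Lk := \sum_(j < first_delay i) w k j *: 'X^j + 'X^(first_delay i) in
    factors w k.+1 (P - star << P@_i *g reduce i >> Lk) s Q ->
    factors w k P ((P@_i, reduce i, Lk) :: s) Q.

End DelayPolynomials.

Definition map_coef (K K' : comNzRingType) (f : K -> K') (A : dpoly K) :
    dpoly K' :=
  \sum_(i <- msupp A) << f A@_i *g i >>.

(* Real polynomials in the doubly indexed parameters w_kj. *)
Notation ppoly R := {malg R[{cmonom (nat * nat)%type}]}.

Section Algorithm.
Variable R : realType.

Definition param (k j : nat) : ppoly R := << ucm (k, j) >>.

(* A rule gives a value to every pair (k, j); the values at pairs which are not
   the index of a parameter play no role. *)
Definition eval_param (a : nat -> nat -> R) : ppoly R -> R :=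
  mmap idfun (fun m : {cmonom (nat * nat)%type} =>
    \prod_(x <- finsupp (cmonom_val m)) a x.1 x.2 ^+ m x).

(* Formal[A] is the sum of the summands in s, plus Q; it includes the summand
   delta_0 * A_l. *)
Definition formal (A : dpoly R) (s : seq (summand (ppoly R)))
    (Q : dpoly (ppoly R)) : Prop :=
  exists2 s', factors param 1%N (map_coef (@malgC _ R) (nonlinpart A)) s' Q &
    s = rcons s' (1, mi_of [:: 0%N], map_poly (@malgC _ R) (linpart A)).

Definition eval_linear (a : nat -> nat -> R) (s : seq (summand (ppoly R))) :
    seq {poly R} :=
  [seq map_poly (eval_param a) x.2 | x <- s].

Definition is_gcd (g : {poly R}) (s : seq {poly R}) : Prop :=
  g %= \big[@gcdp R/0]_(p <- s) p.

Definition rule : Type := ((nat -> nat -> R) * (nat -> nat -> R))%type.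

Local Open Scope classical_set_scope.

(* [gL] and [gM] are the chosen greatest common divisors. The condition on Ahat
   and Bhat bears on all the pairs in LL x MM, so it constrains U as a whole and
   there need not be a largest U: every nonempty U that satisfies the conditions
   gives an output. *)
Definition algorithmI (A B : dpoly R) (LL MM : set {poly R}) : Prop :=
  exists sA QA sB QB,
    [/\ formal A sA QA, formal B sB QB &
    exists (U : set rule) (gL gM : rule -> {poly R}),
      U !=set0 /\
      [/\ forall r, U r ->
            map_coef (eval_param r.1) QA = 0 /\
            map_coef (eval_param r.2) QB = 0,
          forall r, U r ->
            is_gcd (gL r) (eval_linear r.1 sA) /\
            is_gcd (gM r) (eval_linear r.2 sB),
          LL = gL @` U,
          MM = gM @` U &
          forall L M, LL L -> MM M ->
            exists Ahat Bhat : dpoly R,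
              [/\ A = star Ahat L, B = star Bhat M,
                  proper Ahat, proper Bhat & Ahat = Bhat]]].

Definition causal_seq (y : int -> R) : Prop := forall t, t < 0 -> y t = 0.

Definition causal_system (A B : dpoly R) : Prop :=
  [/\ linpart A != 0, mindelay (lin (linpart A)) = mindelay A &
      (mindelay A < mindelay B)%N].

Definition solves (A B : dpoly R) (u y : int -> R) : Prop :=
  causal_seq y /\
  forall t : nat, (maxdelay A <= t)%N -> act A y t%:Z = act B u t%:Z.

(* y is the output for the input u and the initial conditions
   y(0), ..., y(k-1). The equation need not determine it: for
   A = (delta_0 + delta_0 delta_1) * (delta_0 + delta_1) and
   B = (epsilon_0 + epsilon_0 epsilon_1) * epsilon_1, if u(t-2) = -1 and
   y(t-1) + y(t-2) = -1 then y(t) is arbitrary. Uniqueness is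
   what makes y a function of the input and the initial conditions. *)
Definition is_output (A B : dpoly R) (u y : int -> R) : Prop :=
  solves A B u y /\
  forall z, solves A B u z ->
    (forall t : nat, (t < maxdelay A)%N -> z t%:Z = y t%:Z) ->
    forall t, z t = y t.

(* k and l are the maximum output delays of the systems with outputs y and psi,
   l <= k. *)
Definition identical_ic (k l : nat) (y psi : int -> R) : Prop :=
  (forall t : nat, (t < l)%N -> psi t%:Z = y t%:Z) /\
  (forall t : nat, (l <= t < k)%N -> y t%:Z = psi t%:Z).

(* The first system is (A, B), the second one is (A', B'). The existence clause
   ensures that the coincidence of the outputs is not due to a lack of solutions
   of the first system. *)
Definition equivalent_systems (A B A' B' : dpoly R) : Prop :=
  forall u psi, causal_seq u -> is_output A' B' u psi ->
    (exists2 y, solves A B u y &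
       identical_ic (maxdelay A) (maxdelay A') y psi) /\
    (forall y, is_output A B u y ->
       identical_ic (maxdelay A) (maxdelay A') y psi ->
       forall t, y t = psi t).

End Algorithm.

(* Main.v *)
Require Import Defs.
From HB Require Import structures.
From mathcomp Require Import all_boot all_order all_algebra finmap.
From mathcomp Require Import monalg.
From mathcomp Require Import classical_sets reals.

Set Implicit Arguments.
Unset Strict Implicit.
Unset Printing Implicit Defensive.

Import Order.TTheory GRing.Theory Num.Theory.
Local Open Scope ring_scope.

(** The algorithm guarantees a common polynomial C with A = C * L and B = C * M,
    so that, as operators, A y = C (L y) and B u = C (M u). If L psi = M u holds
    from some time on, applying C to both sides gives A psi = B u, except that C
    looks into the past: the value at time t of C (L psi) involves L psi at the
    times t - a, for the delays a of C. These times must not precede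
    maxdelay (lin L), where the linear equation starts to hold. As the equation
    of the first system starts at the time maxdelay A, what has to be shown is
    [maxdelay_star]: for every delay a of C,

        a + deg L <= maxdelay (C * L),

    that is, the terms of largest delay cannot all cancel in a star-product. It
    follows that psi is itself a solution of A y = B u with the right initial
    conditions ([solves_star]); an output of that system is by definition the
    only solution with its initial conditions, hence is equal to psi. The linear part of A, nonzero by causality, serves to
    exclude L = 0.

    The star-product is a substitution in several variables. The Kronecker
    substitution delta_a := X^(N^a), for N larger than the number of factors of
    the terms at hand, turns it into a computation with univariate polynomials:
    multiindices go to distinct monomials, whose degree [weight] is additive,
    and shifting all the delays by l multiplies the degree by N^l. So the term
    of C of largest weight w contributes to C * L a monomial of degree
    N^(deg L) w that no other term of C can reach. *)

(** * Weights of multiindices *)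

(** The degree of the image of delta_s under delta_a := X^(N^a). When s has
    fewer than N entries, this is the number whose a-th digit in base N is the
    multiplicity of a in s. *)
Definition weight (N : nat) (s : seq nat) : nat := (\sum_(a <- s) N ^ a)%N.

Lemma weight_perm N s t : perm_eq s t -> weight N s = weight N t.
Proof. by move=> st; apply: perm_big. Qed.

Lemma leq_weight N a s : a \in s -> (N ^ a <= weight N s)%N.
Proof.
by move=> sa; rewrite (weight_perm _ (perm_to_rem sa)) /weight big_cons leq_addr.
Qed.

(** No carry occurs among fewer than N powers of N, so the weight locates the
    largest entry. *)
Lemma weight_ltn N b s : (size s < N)%N -> (forall a, a \in s -> (a < b)%N) ->
  (weight N s < N ^ b)%N.
Proof.
case: b => [|b] sN ltb.
  case: s sN ltb => [|a s] _ ltb; first by rewrite /weight big_nil.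
  by have := ltb a (mem_head _ _).
have N0 : (0 < N)%N := leq_ltn_trans (leq0n _) sN.
apply: (@leq_ltn_trans (size s * N ^ b)); last first.
  by rewrite expnS ltn_pmul2r // expn_gt0 N0.
rewrite /weight -sum1_size big_distrl /= !big_seq.
by apply: leq_sum => a /ltb; rewrite mul1n ltnS => /leq_pexp2l->.
Qed.

(** Uniqueness of the digits in base N: equal weights force equal largest
    entries, by [leq_weight] and [weight_ltn], and these can be removed. *)
Lemma weight_inj N s t : (1 < N)%N -> (size s < N)%N -> (size t < N)%N ->
  weight N s = weight N t -> perm_eq s t.
Proof.
move=> N1.
have N0 : (0 < N)%N := ltnW N1.
have top r : r != [::] -> (size r < N)%N -> exists2 b, b \in r &
    (N ^ b <= weight N r < N ^ b.+1)%N.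
  case: r => // a r _ rN; have [i ir imax] : exists2 i, i \in a :: r &
      forall j, j \in a :: r -> (j <= i)%N.
    exists (\max_(i <- a :: r) i)%N => [|j jr]; last exact: leq_bigmax_seq.
    elim: r {rN} a => [|c r IH] a; first by rewrite big_seq1 mem_head.
    rewrite big_cons maxnC /maxn; case: ifP => _; first exact: mem_head.
    by rewrite inE IH orbT.
  exists i => //; apply/andP; split; first exact: leq_weight.
  exact: weight_ltn.
have [n] := ubnP (size s); elim: n s t => // n IH s t lt_sn sN tN wE.
have wpos r a : a \in r -> (0 < weight N r)%N.
  by move=> /(leq_weight N); apply: leq_trans; rewrite expn_gt0 N0.
have [s0|s0] := eqVneq s [::].
  case: t tN wE => [|a t] _; first by rewrite s0.
  by rewrite s0 /weight big_nil => /esym E; have := wpos _ _ (mem_head a t);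
     rewrite /weight E.
have [t0|t0] := eqVneq t [::].
  have [b bs _] := top s s0 sN.
  by have := wpos _ _ bs; rewrite wE t0 /weight big_nil.
have [b bs /andP[b1 b2]] := top s s0 sN.
have [c ct /andP[c1 c2]] := top t t0 tN.
have bc : b = c.
  apply/eqP; rewrite eqn_leq -ltnS -(ltn_exp2l _ _ N1).
  rewrite (leq_ltn_trans b1) ?wE //= -ltnS -(ltn_exp2l _ _ N1).
  by rewrite (leq_ltn_trans c1) -?wE.
subst c; have sb := perm_to_rem bs; have tb := perm_to_rem ct.
rewrite (permPl sb) (permPr tb) perm_cons.
have /perm_size /= sz := sb; have /perm_size /= tz := tb.
apply: IH.
- by rewrite -ltnS -sz.
- by rewrite (ltn_trans _ sN) // sz.
- by rewrite (ltn_trans _ tN) // tz.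
- move: wE; rewrite (weight_perm _ sb) (weight_perm _ tb) /weight !big_cons.
  by move/addnI.
Qed.

Lemma weight_mi_inj N (i j : multiindex) :
  (1 < N)%N -> (size i < N)%N -> (size j < N)%N ->
  weight N i = weight N j -> i = j.
Proof.
move=> N1 iN jN /(weight_inj N1 iN jN) /mi_of_perm.
by rewrite !mi_ofK.
Qed.

(** * The Kronecker substitution *)

Section Kronecker.
Variables (K : idomainType) (N : nat).

Definition kron_mi (i : multiindex) : {poly K} := 'X^(weight N i).

Fact kron_mi_is_multiplicative : mmorphism kron_mi.
Proof.
split=> [i j|]; last by rewrite /kron_mi /weight big_nil.
rewrite /kron_mi -exprD; congr ('X^_).
by rewrite /weight (perm_big _ (permEl (perm_sort leq (i ++ j)))) big_cat.
Qed.

HB.instance Definition _ :=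
  isMultiplicative.Build multiindex {poly K} kron_mi kron_mi_is_multiplicative.

Definition kron (A : dpoly K) : {poly K} := mmap polyC kron_mi A.

Lemma kron_lin p : kron (lin p) = \sum_(j < size p) p`_j *: 'X^(N ^ j).
Proof.
rewrite /kron /lin raddf_sum; apply: eq_bigr => j _ /=.
by rewrite mmapU /kron_mi /weight (_ : mi_seq _ = [:: val j]) // big_seq1
           -mul_polyC.
Qed.

(** The powers N^j increase strictly with j, so that the leading term of p
    stays the leading one. *)
Lemma size_kron_lin p : (1 < N)%N -> p != 0 ->
  size (kron (lin p)) = (N ^ (size p).-1).+1.
Proof.
move=> N1 p0; rewrite kron_lin.
have: (size p).-1.+1 = size p by rewrite prednK // size_poly_gt0.
have: p`_(size p).-1 != 0 by rewrite -lead_coefE lead_coef_eq0.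
move: (size p).-1 => n pn <-; rewrite big_ord_recr /= addrC size_polyDl.
  by rewrite size_scale // size_polyXn.
rewrite size_scale // size_polyXn ltnS.
apply: (leq_trans (size_sum _ _ _)); apply/bigmax_leqP => j _.
by rewrite (leq_trans (size_scale_leq _ _)) // size_polyXn ltn_exp2l.
Qed.

Lemma kron_star A L : kron (star A L) = \sum_(i <- msupp A)
  A@_i *: \prod_(a <- mi_seq i) kron (lin ('X^a * L)).
Proof.
rewrite /star mmapE /kron raddf_sum; apply: eq_bigr => i _ /=.
by rewrite rmorphM /= mmapC rmorph_prod mul_polyC.
Qed.

(** Each factor lin (X^a * L) has the largest delay a + deg L, so its image has
    degree N^(a + deg L); degrees add up in an integral domain. *)
Lemma size_kron_star_term (s : seq nat) (L : {poly K}) :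
  (1 < N)%N -> L != 0 ->
  size (\prod_(a <- s) kron (lin ('X^a * L))) =
    (N ^ (size L).-1 * weight N s).+1.
Proof.
move=> N1 L0; elim: s => [|a s IH].
  by rewrite big_nil /weight big_nil muln0 size_poly1.
have XL0 : 'X^a * L != 0 by rewrite mulf_neq0 // -size_poly_gt0 size_polyXn.
have sz : size (kron (lin ('X^a * L))) = (N ^ (a + (size L).-1)).+1.
  rewrite size_kron_lin // size_mul //; last by rewrite -size_poly_gt0 size_polyXn.
  rewrite size_polyXn addSn /= -subn1 -addnBA ?subn1 ?size_poly_gt0 //.
rewrite big_cons size_mul -?size_poly_gt0 ?IH ?sz //.
by rewrite /weight big_cons mulnDr addSn addnS -expnD [(_ + a)%N]addnC.
Qed.

Lemma mem_msupp_kron A n : (kron A)`_n != 0 ->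
  exists2 i, i \in msupp A & weight N i = n.
Proof.
move=> An; have [/hasP[i iA /eqP]|/hasPn none] :=
  boolP (has (fun i : multiindex => weight N i == n) (msupp A)).
  by exists i.
case/negP: An; rewrite /kron mmapE coef_sum big_seq big1 // => i /none.
by rewrite coefCM /kron_mi coefXn eq_sym => /negPf->; rewrite mulr0.
Qed.

End Kronecker.

(** * Delays of a star-product *)

Lemma leq_maxdelay (K : comNzRingType) (A : dpoly K) (i : multiindex) a :
  i \in msupp A -> a \in mi_seq i -> (a <= maxdelay A)%N.
Proof.
move=> iA ai; apply: (@leq_trans (\max_(b <- mi_seq i) b)).
  exact: leq_bigmax_seq.
exact: (@leq_bigmax_seq _ _ _ (fun i : multiindex => \max_(b <- mi_seq i) b)%N).
Qed.

(** Let j be the multiindex of A of largest weight. The weights being distinct,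
    the coefficient of the image of A * L at the degree N^(deg L) * weight j is
    the product of A@_j and a power of the leading coefficient of L, hence some
    term h of A * L has exactly this weight. It is at least N^(a + deg L), which
    by [weight_ltn] is too much if all the delays of h are below a + deg L. *)
Lemma maxdelay_star (K : idomainType) (A : dpoly K) (L : {poly K})
    (i : multiindex) a :
  L != 0 -> i \in msupp A -> a \in mi_seq i ->
  (a + (size L).-1 <= maxdelay (star A L))%N.
Proof.
move=> L0 iA ai; set l := (size L).-1; set C := star A L.
pose degree (D : dpoly K) := (\max_(j <- msupp D) size (mi_seq j))%N.
(* N exceeds the size of all the multiindices of A and C, and 1 even if these
   are all empty. *)
pose N := (degree A + degree C).+2.
have N1 : (1 < N)%N by [].
have AN j : j \in msupp A -> (size (mi_seq j) < N)%N.
  move=> jA; rewrite /N ltnS; apply: leq_trans (leqnSn _).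
  apply: leq_trans (leq_addr _ _).
  exact: (@leq_bigmax_seq _ _ _ (fun j : multiindex => size (mi_seq j))).
have CN j : j \in msupp C -> (size (mi_seq j) < N)%N.
  move=> jC; rewrite /N ltnS; apply: leq_trans (leqnSn _).
  apply: leq_trans (leq_addl _ _).
  exact: (@leq_bigmax_seq _ _ _ (fun j : multiindex => size (mi_seq j))).
have [j jA jmax] : exists2 j, j \in msupp A &
    forall h, h \in msupp A -> (weight N h <= weight N j)%N.
  have [j _ jmax] := @arg_maxnP (msupp A) (FSetSub iA) xpredT
    (fun h => weight N (val h)) isT.
  by exists (val j) => [|h hA]; [exact: valP|exact: (jmax (FSetSub hA))].
have Cj : (kron N C)`_(N ^ l * weight N j) != 0.
  rewrite kron_star coef_sum (big_fsetD1 j) //= [X in _ + X]big1_seq.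
    rewrite addr0 coefZ mulf_neq0 ?mcoeff_neq0 //.
    have -> : (N ^ l * weight N j)%N = (size (\prod_(b <- mi_seq j)
        kron N (lin ('X^b * L)))).-1 by rewrite size_kron_star_term.
    rewrite -lead_coefE.
    by rewrite lead_coef_eq0 -size_poly_gt0 size_kron_star_term.
  move=> h /=; rewrite in_fsetD1 => /andP[hj hA].
  rewrite coefZ [X in _ * X]nth_default ?mulr0 // size_kron_star_term //.
  rewrite ltn_pmul2l ?expn_gt0 // ltn_neqAle jmax // andbT.
  by apply: contra hj => /eqP /(weight_mi_inj N1 (AN _ hA) (AN _ jA)) ->.
have [h hC hw] := mem_msupp_kron Cj.
have : (N ^ (a + l) <= weight N h)%N.
  rewrite hw expnD mulnC leq_pmul2l ?expn_gt0 //.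
  exact: leq_trans (leq_weight N ai) (jmax _ iA).
apply: contraTT; rewrite -!ltnNge => lt_Cal.
apply: weight_ltn (CN _ hC) _ => b /(leq_maxdelay hC) bC.
exact: leq_ltn_trans bC lt_Cal.
Qed.

Lemma maxdelay_lin (K : comNzRingType) (L : {poly K}) :
  (maxdelay (lin L) <= (size L).-1)%N.
Proof.
apply/bigmax_leqP_seq => i iL _; apply/bigmax_leqP_seq => a ai _.
move: iL; rewrite -mcoeff_neq0; apply: contraNT; rewrite -ltnNge => lt_La.
rewrite /lin raddf_sum big1 // => j _ /=; rewrite mcoeffU.
case: eqP => // ij; move: ai lt_La; rewrite -ij (_ : mi_seq _ = [:: val j]) //.
rewrite inE => /eqP->.
by rewrite ltnNge -ltnS prednK ?ltn_ord // (leq_ltn_trans _ (ltn_ord j)).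
Qed.

(** Substituting 0 kills every term except the constant one. *)
Lemma linpart_star0 (K : comNzRingType) (A : dpoly K) : linpart (star A 0) = 0.
Proof.
have star0 : star A 0 = (\sum_(i <- msupp A | mi_seq i == [::]) A@_i)%:MP.
  rewrite /star mmapE [RHS]raddf_sum [RHS]big_mkcond /=.
  apply: eq_bigr => i _; case: (mi_seq i) => [|a s] /=.
    by rewrite big_nil mulr1.
  by rewrite big_cons mulr0 /lin size_poly0 big_ord0 mul0r mulr0.
apply/polyP=> j; rewrite coef_poly coef0 star0 mcoeffC.
by case: eqP => [/(congr1 mi_seq)//|_]; rewrite mulr0n if_same.
Qed.

(** * Solutions of a factored system *)

Lemma act_eq_in (K : comNzRingType) (A : dpoly K) (y z : int -> K) (t : int) :
  (forall i a, i \in msupp A -> a \in mi_seq i -> y (t - a%:Z) = z (t - a%:Z)) ->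
  act A y t = act A z t.
Proof.
move=> yz; rewrite /act !mmapE; apply: eq_big_seq => i iA; congr (_ * _).
by apply: eq_big_seq => a /(yz _ _ iA).
Qed.

(** The values of L psi and M u that C needs at a time t >= maxdelay (C * L) are
    taken at times t - a >= deg L, where the equation L psi = M u holds. *)
Lemma solves_star (R : realType) (C : dpoly R) (L M : {poly R})
    (u psi : int -> R) :
  L != 0 -> solves (lin L) (lin M) u psi ->
  solves (star C L) (star C M) u psi.
Proof.
move=> L0 [psi_causal psiE]; split=> // t le_t.
rewrite !act_star; apply: act_eq_in => // i a iC ai.
have le_at := leq_trans (maxdelay_star L0 iC ai) le_t.
rewrite subzn ?(leq_trans (leq_addr _ _) le_at) //; apply: psiE.
by rewrite (leq_trans (maxdelay_lin L)) // leq_subRL //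
           (leq_trans (leq_addr _ _) le_at).
Qed.

Theorem theorem3p2 (R : realType) (A B : dpoly R) (LL MM : set {poly R})
    (A_nonlinear : ~ is_linear A) (B_nonlinear : ~ is_linear B)
    (AB_causal : causal_system A B)
    (LL_MM_output : algorithmI A B LL MM)
    (L M : {poly R}) (L_in : LL L) (M_in : MM M) :
  equivalent_systems A B (lin L) (lin M).
Proof.
have [sA [QA [sB [QB [_ _ [U [gL [gM [_ [_ _ _ _ hatE]]]]]]]]]] := LL_MM_output.
have [C [C' [AE BE _ _ CC']]] := hatE _ _ L_in M_in.
have L0 : L != 0.
  have [A1 _ _] := AB_causal; apply: contra_neq A1 => L0.
  by rewrite AE L0 linpart_star0.
move=> u psi _ [psi_solves _].
have psiA : solves A B u psi.
  by rewrite AE BE -CC'; exact: solves_star.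
(* The two output sequences agree at all times below maxdelay A: below
   maxdelay (lin L) by the first clause on the initial conditions, and from
   there on by the second one. *)
split=> [|y [_ y_unique] [psi_y y_psi] t]; first by exists psi.
apply/esym/y_unique => // s lt_s.
by case: (ltnP s (maxdelay (lin L))) => [/psi_y //|le_s]; rewrite y_psi // le_s.
Qed.
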